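(* Let $M$ be a monitor. If $M$ is observationally sound, then $M$ is sound. If $M$ is complete, then $M$ is observationally complete.
   Context: Setting: the logic MTL$^{\downarrow}$ (MTL extended with a freeze quantifier $\downarrow$ binding register values to variables). Truth values are $\mathsf{3}=\{\mathsf{t},\mathsf{f},\bot\}$ and $\mathsf{2}=\{\mathsf{t},\mathsf{f}\}$, partially ordered by knowledge: $\bot\prec\mathsf{t}$, $\bot\prec\mathsf{f}$, with $\mathsf{t},\mathsf{f}$ incomparable; $(\mathsf{3},\prec)$ is a lower semilattice. For a set $S\subseteq\mathsf{3}$, write $\mathrm{Meet}(S)$ for its meet (greatest lower bound) in this order, i.e. $\mathrm{Meet}(S)=b$ if every element of $S$ equals $b\in\mathsf{2}$, and $\bot$ otherwise. Observations are finite words of letters $(I,\sigma,\rho)$ (with $I$ an interval of rationals, $\sigma$ a partial interpretation of predicate symbols, $\rho$ a partial assignment of register values) representing a monitor's partial knowledge, refined by a relation $\sqsubseteq$ (splitting intervals at a timestamp, removing letters, adding data); a timed word can also refine an observation. For an observation $w$, a time $\tau$, a partial valuation $\nu$ and formula $\phi$, the three-valued semantics value $\langle\!\langle w,\tau,\nu\rangle\!\rangle(\phi)\in\mathsf{3}$ is the Kleene-logic value of $\phi$ at the position of $w$ whose interval is $\{\tau\}$, and $\bot$ if there is no such position. For a timed word $v$ and total valuation $\nu$, $[\![v,\tau,\nu]\!](\phi)$ is the standard Boolean value of $\phi$ at the time point of $v$ with timestamp $\tau$, and $\bot$ if no time point has timestamp $\tau$. For an observation $w$, $U_w$ is the set of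 timed words $v$ with $w\sqsubseteq v$. A valid observation sequence is $\bar w=(w_i)_{i\in\mathbb{N}}$ with $w_0=([0,\infty),[\,],[\,])$ and $w_i$ strictly refined by $w_{i+1}$ for all $i$. A monitor $M$ outputs, for each input $w_i$, a finite set $M(w_i)$ of verdicts $(\tau,b)$ with $\tau\in\mathbb{Q}_{\ge0}$, $b\in\mathsf{2}$. $M$ is sound for $\bar w$ and $\phi$ if for all total valuations $\nu$ and $i\in\mathbb{N}$, whenever $(\tau,b)\in M(w_i)$ then $\mathrm{Meet}(\{[\![v,\tau,\nu]\!](\phi) : v\in U_{w_i}\})=b$. $M$ is complete for $\bar w$ and $\phi$ if for all total valuations $\nu$, $i\in\mathbb{N}$, $\tau\in\mathbb{Q}_{\ge0}$, whenever $\mathrm{Meet}(\{[\![v,\tau,\nu]\!](\phi) : v\in U_{w_i}\})\in\mathsf{2}$ then $(\tau,b)\in\bigcup_{j\le i}M(w_j)$ for some $b\in\mathsf{2}$. $M$ is observationally sound for $\bar w$ and $\phi$ if for all partial valuations $\nu$ and $i\in\mathbb{N}$, if $(\tau,b)\in M(w_i)$ then $\langle\!\langle w_i,\tau,\nu\rangle\!\rangle(\phi)=b$. $M$ is observationally complete for $\bar w$ and $\phi$ if for all partial valuations $\nu$, $i\in\mathbb{N}$, $\tau\in\mathbb{Q}_{\ge0}$, if $\langle\!\langle w_i,\tau,\nu\rangle\!\rangle(\phi)\in\mathsf{2}$ then $(\tau,b)\in\bigcup_{j\le i}M(w_j)$ for some $b\in\mathsf{2}$. $M$ is (observationally) sound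 / complete if it is so for all valid observation sequences $\bar w$ and all formulas $\phi$. *)

(* Defs.v *)
(* Mathematical Components, with the classical layer of MathComp-Analysis. *)
From HB Require Import structures.
From Stdlib Require Import Relation_Operators.
From mathcomp Require Import all_boot all_order all_algebra finmap.
From mathcomp Require Import boolp classical_sets.

Set Implicit Arguments.
Unset Strict Implicit.
Unset Printing Implicit Defensive.

Import Order.TTheory GRing.Theory Num.Theory.
Local Open Scope classical_set_scope.
Local Open Scope ring_scope.

(* [Some true], [Some false] and [None] are t, f and "unknown"; the Boolean
   values are the elements of the form [Some b]. *)
Definition tv3 := option bool.
HB.instance Definition _ := Choice.on tv3.

(* Only "unknown" lies strictly below another value. *)
Definition kle (a b : tv3) : bool := (a == None) || (a == b).

Lemma kle_refl : reflexive kle.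
Proof. by case=> [[]|]. Qed.
Lemma kle_anti : antisymmetric kle.
Proof. by case=> [[]|] [[]|]. Qed.
Lemma kle_trans : transitive kle.
Proof. by case=> [[]|] [[]|] [[]|]. Qed.

Fact knowledge_display : Order.disp_t. Proof. exact: Order.Disp tt tt. Qed.
HB.instance Definition _ := Order.Le_isPOrder.Build knowledge_display tv3
  kle_refl kle_anti kle_trans.

(* The empty set has no greatest lower bound in tv3; its meet is set to
   "unknown" by convention. *)
Definition Meet (S : set tv3) : tv3 := infimum (None : tv3) S.

Lemma Meet_some (S : set tv3) (b : bool) :
  Meet S = Some b <-> S !=set0 /\ S `<=` [set Some b].
Proof.
rewrite /Meet /infimum; split=> [|[S0 Sb]]; last first.
  case: ifPn => [/eqP S00|_]; first by case: S0 => a; rewrite S00.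
  have -> : S = [set Some b].
    by apply/seteqP; split=> // _ ->; case: S0 => a Sa; rewrite -(Sb a Sa).
  by rewrite infimums1; case: xgetP => [_ -> //|/(_ (Some b)) []].
case: ifPn => // /set0P S0; case: xgetP => [_ -> [lbS _] bE|//].
split=> // a /lbS; rewrite bE => ba; apply/eqP; rewrite eq_sym.
exact: ba.
Qed.

Definition kneg (a : tv3) : tv3 := omap negb a.
Definition kor (a b : tv3) : tv3 :=
  match a, b with
  | Some true, _ | _, Some true => Some true
  | Some false, Some false => Some false
  | _, _ => None
  end.
Definition kand (a b : tv3) : tv3 := kneg (kor (kneg a) (kneg b)).
Definition kimp (a b : tv3) : tv3 := kor (kneg a) b.

(* A set of nonnegative rationals closed under betweenness; its bounds need not
   be rational. *)
Record qinterval := QInterval {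
  qitv :> set rat;
  qitv_neq0 : qitv !=set0;
  qitv_ge0 : forall t, qitv t -> 0 <= t;
  qitv_convex : forall s t, qitv s -> qitv t ->
    forall u, s <= u <= t -> qitv u
}.

Record signature := Signature {
  predsym : Type;
  arity : predsym -> nat;
  register : Type;
  variable : eqType;
  domain : Type;
  domain_inhabited : inhabited domain
}.

(* Partial functions take values in [option]; [pext f g] says that [g]
   extends [f]. *)
Definition pext (A : Type) (B : A -> Type) (f g : forall a, option (B a)) :=
  forall a b, f a = Some b -> g a = Some b.

Section Logic.
Variable Sg : signature.

Inductive formula :=
  | FTrue
  | FPred (p : predsym Sg) (xs : (arity p).-tuple (variable Sg))
  | FFreeze (r : register Sg) (x : variable Sg) (phi : formula)
  | FNot (phi : formula)
  | FOr (phi psi : formula)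
  | FUntil (J : qinterval) (phi psi : formula).

Definition relation_on (p : predsym Sg) := set ((arity p).-tuple (domain Sg)).
Definition pinterp := forall p : predsym Sg, option (relation_on p).
Definition pregs := register Sg -> option (domain Sg).
Definition pvaluation := variable Sg -> option (domain Sg).

Record letter := Letter {
  litv : set rat;
  linterp : pinterp;
  lregs : pregs
}.
Definition word := seq letter.

Definition no_interp : pinterp := fun _ => None.
Definition no_regs : pregs := fun _ => None.
Definition init_letter := Letter [set t | 0 <= t] no_interp no_regs.
Definition init_obs : word := [:: init_letter].

Definition singular (I : set rat) := exists t, I = [set t].

Definition drop_empty (w : word) : word := [seq l <- w | litv l != set0].

(* One transformation of an observation.  In a split, a part with an empty
   interval (the left one when the split point is 0) yields no letter.  Letters
   with a nonsingular interval of an observation carry no data, so that the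
   three parts of a split carry none either. *)
Inductive refine1 : word -> word -> Prop :=
  | RefineSplit u v I s r t : ~ is_subset1 I -> I t ->
      refine1 (u ++ Letter I s r :: v)
        (u ++ drop_empty [:: Letter (I `&` [set x | x < t]) s r;
                             Letter [set t] s r;
                             Letter (I `&` [set x | t < x]) s r] ++ v)
  | RefineRemove u v I s r : ~ is_subset1 I -> has_ubound I ->
      refine1 (u ++ Letter I s r :: v) (u ++ v)
  | RefineData u v t s r s' r' : pext s s' -> pext r r' ->
      refine1 (u ++ Letter [set t] s r :: v) (u ++ Letter [set t] s' r' :: v).

Definition refines : word -> word -> Prop := clos_refl_trans word refine1.
Definition strictly_refines (w w' : word) := refines w w' /\ w <> w'.

Record timed_word := TimedWord {
  stamp : nat -> rat;
  tinterp : nat -> forall p, relation_on p;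
  tregs : nat -> register Sg -> domain Sg;
  stamp_ge0 : forall i, 0 <= stamp i;
  stamp_incr : forall i j, (i < j)%N -> stamp i < stamp j;
  stamp_progress : forall t : rat, exists i, t < stamp i
}.
Arguments tinterp : clear implicits.

(* [w] is refined by the timed word [v]: [f] maps each time point of [v] to the
   letter of [w] that it comes from.  No time point may fall in a gap left by a
   removed letter, and every time point of [w] persists in [v]. *)
Definition refines_tw (w : word) (v : timed_word) :=
  exists f : nat -> nat,
    [/\ forall j, (f j < size w)%N,
        forall i j, (i <= j)%N -> (f i <= f j)%N,
        forall j, let l := nth init_letter w (f j) in
          [/\ litv l (stamp v j),
              pext (linterp l) (fun p => Some (tinterp v j p)) &
              pext (lregs l) (fun r => Some (tregs v j r))] &
        forall i, (i < size w)%N -> singular (litv (nth init_letter w i)) ->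
          exists j, f j = i].

Definition U_ (w : word) : set timed_word := [set v | refines_tw w v].

Definition update (B : Type) (nu : variable Sg -> B) (x : variable Sg) (d : B) :=
  fun y => if y == x then d else nu y.

Fixpoint sat (v : timed_word) (i : nat) (nu : variable Sg -> domain Sg)
    (phi : formula) : Prop :=
  match phi with
  | FTrue => True
  | FPred p xs => tinterp v i p (map_tuple nu xs)
  | FFreeze r x phi => sat v i (update nu x (tregs v i r)) phi
  | FNot phi => ~ sat v i nu phi
  | FOr phi psi => sat v i nu phi \/ sat v i nu psi
  | FUntil J phi psi => exists j, [/\ (i <= j)%N, qitv J (stamp v j - stamp v i),
      sat v j nu psi & forall k, (i <= k < j)%N -> sat v k nu phi]
  end.

(* The time point with timestamp [t], if any, is unique since timestamps are
   strictly increasing. *)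
Definition tw_val (v : timed_word) (t : rat) (nu : variable Sg -> domain Sg)
    (phi : formula) : tv3 :=
  if `[< exists i, stamp v i = t >]
  then Some `[< exists i, stamp v i = t /\ sat v i nu phi >]
  else None.

Definition tp (w : word) (j : nat) : tv3 :=
  if `[< singular (litv (nth init_letter w j)) >] then Some true else None.

(* Metric constraint between positions [i] and [j]: does the difference of their
   timestamps, known only up to the letters' intervals, lie in [J]? *)
Definition mc (w : word) (i j : nat) (J : qinterval) : tv3 :=
  let Ii := litv (nth init_letter w i) in
  let Ij := litv (nth init_letter w j) in
  if `[< forall s t, Ii s -> Ij t -> qitv J (t - s) >] then Some true
  else if `[< forall s t, Ii s -> Ij t -> ~ qitv J (t - s) >] then Some false
  else None.

(* In the predicate case, [pmap nu xs] has size [arity p], so that [insub]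
   succeeds, iff [nu] is defined on all of [xs]. *)
Fixpoint sem3 (w : word) (i : nat) (nu : pvaluation) (phi : formula) : tv3 :=
  match phi with
  | FTrue => Some true
  | FPred p xs =>
      match linterp (nth init_letter w i) p,
            (insub (pmap nu xs) : option ((arity p).-tuple (domain Sg))) with
      | Some A, Some ds => Some `[< A ds >]
      | _, _ => None
      end
  | FFreeze r x phi =>
      sem3 w i (update nu x (lregs (nth init_letter w i) r)) phi
  | FNot phi => kneg (sem3 w i nu phi)
  | FOr phi psi => kor (sem3 w i nu phi) (sem3 w i nu psi)
  | FUntil J phi psi =>
      \big[kor/Some false]_(i <= j < size w)
        kand (tp w j) (kand (mc w i j J) (kand (sem3 w j nu psi)
          (\big[kand/Some true]_(i <= k < j) kimp (tp w k) (sem3 w k nu phi))))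
  end.

Definition obs_val (w : word) (t : rat) (nu : pvaluation) (phi : formula) : tv3 :=
  let i := find (fun l => `[< litv l = [set t] >]) w in
  if (i < size w)%N then sem3 w i nu phi else None.

Definition valid_obs_seq (w : nat -> word) :=
  w 0%N = init_obs /\ forall i, strictly_refines (w i) (w i.+1).

(* A monitor is run for a given formula and processes observations one at a
   time; its output on the current observation (the last one of the list) may
   depend on those received before. *)
Record monitor := Monitor {
  verdicts :> formula -> seq word -> {fset rat * bool};
  verdicts_ge0 : forall phi ws t b, (t, b) \in verdicts phi ws -> 0 <= t
}.

(* M(w_i), for the monitor run for [phi] on the sequence [w]. *)
Definition output (M : monitor) (phi : formula) (w : nat -> word) (i : nat) :=
  M phi (mkseq w i.+1).

Definition tw_meet (w : word) (t : rat) (nu : variable Sg -> domain Sg)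
    (phi : formula) : tv3 :=
  Meet [set tw_val v t nu phi | v in U_ w].

Definition sound_for (M : monitor) (w : nat -> word) (phi : formula) :=
  forall (nu : variable Sg -> domain Sg) i t b,
    (t, b) \in output M phi w i -> tw_meet (w i) t nu phi = Some b.

Definition complete_for (M : monitor) (w : nat -> word) (phi : formula) :=
  forall (nu : variable Sg -> domain Sg) i (t : rat), 0 <= t ->
    tw_meet (w i) t nu phi <> None ->
    exists b, exists2 j, (j <= i)%N & (t, b) \in output M phi w j.

Definition obs_sound_for (M : monitor) (w : nat -> word) (phi : formula) :=
  forall (nu : pvaluation) i t b,
    (t, b) \in output M phi w i -> obs_val (w i) t nu phi = Some b.

Definition obs_complete_for (M : monitor) (w : nat -> word) (phi : formula) :=
  forall (nu : pvaluation) i (t : rat), 0 <= t ->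
    obs_val (w i) t nu phi <> None ->
    exists b, exists2 j, (j <= i)%N & (t, b) \in output M phi w j.

Definition sound (M : monitor) :=
  forall w phi, valid_obs_seq w -> sound_for M w phi.
Definition complete (M : monitor) :=
  forall w phi, valid_obs_seq w -> complete_for M w phi.
Definition obs_sound (M : monitor) :=
  forall w phi, valid_obs_seq w -> obs_sound_for M w phi.
Definition obs_complete (M : monitor) :=
  forall w phi, valid_obs_seq w -> obs_complete_for M w phi.

End Logic.

(* Main.v *)
From Stdlib Require Import Relation_Operators.
From mathcomp Require Import all_boot all_order all_algebra finmap lra.
From mathcomp Require Import boolp classical_sets.
Require Import Defs.

(** A Boolean value of the three-valued semantics at a letter is inherited by
    every time point of every refining timed word that lies in this letter, by
    induction on the formula.  The crucial case is "until": a true disjunct is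
    witnessed by a letter known to be a time point, which persists in the timed
    word; a false disjunct refutes all time points in its letter, because a
    counterexample to the left argument again sits at a known time point.  To
    turn this into a statement about meets, an observation obtained from the
    initial one must have a refining timed word, since the meet of the empty set
    is "unknown".  This holds because refinement preserves that the intervals
    are nonempty and increasing with the last one unbounded. *)

Set Implicit Arguments.
Unset Strict Implicit.
Unset Printing Implicit Defensive.

Import Order.TTheory GRing.Theory Num.Theory.
Local Open Scope classical_set_scope.
Local Open Scope ring_scope.

(** * Inversion of the Kleene connectives *)

Lemma kneg_some a b : kneg a = Some b -> a = Some (~~ b).
Proof. by case: a => [[]|] // [<-]. Qed.

Lemma kand_true a b : kand a b = Some true -> a = Some true /\ b = Some true.
Proof. by case: a b => [[]|] [[]|]. Qed.

Lemma kand_false a b : kand a b = Some false -> a = Some false \/ b = Some false.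
Proof. by case: a b => [[]|] [[]|] //; auto. Qed.

Lemma kor_true a b : kor a b = Some true -> a = Some true \/ b = Some true.
Proof. by case: a b => [[]|] [[]|] //; auto. Qed.

Lemma kor_false a b : kor a b = Some false -> a = Some false /\ b = Some false.
Proof. by case: a b => [[]|] [[]|]. Qed.

Lemma bigkor_true m n (F : nat -> tv3) :
  \big[kor/Some false]_(m <= i < n) F i = Some true ->
  exists2 i, (m <= i < n)%N & F i = Some true.
Proof.
rewrite big_nat; elim/big_ind: _ => // [x y IHx IHy /kor_true[]|i]; first exact.
- exact.
- by exists i.
Qed.

Lemma bigkor_false m n (F : nat -> tv3) :
  \big[kor/Some false]_(m <= i < n) F i = Some false ->
  forall i, (m <= i < n)%N -> F i = Some false.
Proof.
move=> + i; rewrite -mem_index_iota.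
elim: (index_iota m n) => // k s IHs; rewrite big_cons => /kor_false[Fk Fs].
by rewrite in_cons => /predU1P[->//|]; exact: IHs.
Qed.

Lemma bigkand_true m n (F : nat -> tv3) :
  \big[kand/Some true]_(m <= i < n) F i = Some true ->
  forall i, (m <= i < n)%N -> F i = Some true.
Proof.
move=> + i; rewrite -mem_index_iota.
elim: (index_iota m n) => // k s IHs; rewrite big_cons => /kand_true[Fk Fs].
by rewrite in_cons => /predU1P[->//|]; exact: IHs.
Qed.

Lemma bigkand_false m n (F : nat -> tv3) :
  \big[kand/Some true]_(m <= i < n) F i = Some false ->
  exists2 i, (m <= i < n)%N & F i = Some false.
Proof.
rewrite big_nat; elim/big_ind: _ => // [x y IHx IHy /kand_false[]|i]; first exact.
- exact.
- by exists i.
Qed.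

(** * Letters, time points and valuations *)

Section Observations.
Variable Sg : signature.
Implicit Types (w u v m : word Sg) (l : letter Sg) (tw : timed_word Sg).
Local Notation init := (init_letter Sg).

Lemma stamp_inj tw : injective (stamp tw).
Proof.
by move=> i j e; case: (ltngtP i j) => // /(stamp_incr tw); rewrite e ltxx.
Qed.

Lemma tp_true w k : tp w k = Some true -> singular (litv (nth init w k)).
Proof. by rewrite /tp; case: ifPn => // /asboolP. Qed.

Lemma tp_neq_false w k : tp w k <> Some false.
Proof. by rewrite /tp; case: ifPn. Qed.

Lemma mc_some w i j J b : mc w i j J = Some b ->
  forall s t, litv (nth init w i) s -> litv (nth init w j) t ->
  (qitv J (t - s) <-> b).
Proof.
rewrite /mc; case: ifPn => [/asboolP H [<-] s t Is Jt|_].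
  by split=> // _; exact: H.
by case: ifPn => // /asboolP H [<-] s t Is Jt; split=> // /(H _ _ Is Jt).
Qed.

(** Used for freeze: [a] is the possibly unknown register value in a letter, [d] the actual value at
    a time point. *)
Lemma pext_update (nu : pvaluation Sg) (nu' : variable Sg -> domain Sg) x a d :
  pext nu (fun y => Some (nu' y)) -> (forall c, a = Some c -> d = c) ->
  pext (update nu x a) (fun y => Some (update nu' x d y)).
Proof.
move=> nuP ad y c; rewrite /update; case: eqP => _; last exact: nuP.
by move=> /ad ->.
Qed.

(** [pmap] drops undefined entries, so an unchanged size means that [g] is defined throughout
    [s]. *)
Lemma pmap_pext (T U : Type) (g : T -> option U) (h : T -> U) (s : seq T) :
  pext g (fun x => Some (h x)) -> size (pmap g s) = size s ->
  pmap g s = [seq h x | x <- s].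
Proof.
move=> gh; elim: s => //= x s IHs.
case gx: (g x) => [y|] /=; last first.
  move=> e; have : (size (pmap g s) <= size s)%N.
    by rewrite size_pmap count_size.
  by rewrite e ltnn.
by move=> [/IHs ->]; have [->] := gh _ _ gx.
Qed.

(** * Transfer of Boolean values along a fixed witness [f] of [refines_tw w tw] *)

Section Refinement.
Variables (w : word Sg) (tw : timed_word Sg) (f : nat -> nat).
Hypothesis f_size : forall j, (f j < size w)%N.
Hypothesis f_homo : forall i j, (i <= j)%N -> (f i <= f j)%N.
Hypothesis f_data : forall j, let l := nth init w (f j) in
  [/\ litv l (stamp tw j),
      pext (linterp l) (fun p => Some (@tinterp _ tw j p)) &
      pext (lregs l) (fun r => Some (tregs tw j r))].
Hypothesis f_onto : forall i, (i < size w)%N ->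
  singular (litv (nth init w i)) -> exists j, f j = i.

Lemma litv_stamp j : litv (nth init w (f j)) (stamp tw j).
Proof. by case: (f_data j). Qed.

Lemma singular_preim_inj i j :
  singular (litv (nth init w (f i))) -> f i = f j -> i = j.
Proof.
case=> t It fij; apply: (@stamp_inj tw).
have := litv_stamp i; have := litv_stamp j.
by rewrite -fij It /= => -> ->.
Qed.

Lemma f_lt i j : (f i < f j)%N -> (i < j)%N.
Proof. by rewrite !ltnNge; apply: contra; exact: f_homo. Qed.

(** Several time points may share a letter, so [f] alone does not reflect the order; a singular
    letter has only one. *)
Lemma singular_preim_le i j :
  singular (litv (nth init w (f i))) \/ singular (litv (nth init w (f j))) ->
  (f i <= f j)%N -> (i <= j)%N.
Proof.
move=> sing; rewrite leq_eqVlt => /predU1P[e|/f_lt/ltnW//].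
case: sing => /singular_preim_inj; first by move=> /(_ _ e) ->.
by move=> /(_ _ (esym e)) ->.
Qed.

Lemma sem3_sat phi : forall j (nu : pvaluation Sg) nu' b,
  pext nu (fun x => Some (nu' x)) ->
  sem3 w (f j) nu phi = Some b -> (sat tw j nu' phi <-> b).
Proof.
elim: phi => [|p xs|r x phi IH|phi IH|phi IHphi psi IHpsi|J phi IHphi psi IHpsi]
    j nu nu' b nuP /=.
- by case=> <-.
- case: (f_data j) => _ /(_ p) + _; case: (linterp _ p) => // A /(_ _ erefl)[<-].
  case: insubP => // ds /eqP szds dsE [<-].
  suff -> : map_tuple nu' xs = ds by split=> /asboolP.
  apply: val_inj; rewrite dsE /= (pmap_pext nuP) //.
  by rewrite szds size_tuple.
- apply: IH; apply: pext_update => // c rc.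
  by case: (f_data j) => _ _ /(_ _ _ rc) [].
- move=> /kneg_some /(IH _ _ _ _ nuP) ->; by case: b; split.
- case: b => [/kor_true|/kor_false].
    by case=> [/(IHphi _ _ _ _ nuP)|/(IHpsi _ _ _ _ nuP)] ->; split=> // _;
      [left|right].
  by move=> [/(IHphi _ _ _ _ nuP) -> /(IHpsi _ _ _ _ nuP) ->]; split=> // -[].
- case: b => [/bigkor_true|/bigkor_false] H.
  + split=> // _; case: H => k /andP[jk kw] /kand_true[/tp_true kS].
    have [j' fj'] := f_onto kw kS; rewrite -fj' in jk kS * => /kand_true[Jk].
    move=> /kand_true[psik phik]; exists j'; split.
    * by apply: singular_preim_le => //; right.
    * by apply/(mc_some Jk) => //; exact: litv_stamp.
    * exact/(IHpsi _ _ _ _ nuP psik).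
    * move=> i /andP[ji ij'].
      (* The conjunction in [phik] stops before letter [f j'], which is singular and thus contains
         no time point but [j']. *)
      have fij' : (f i < f j')%N.
        rewrite ltn_neqAle f_homo ?(ltnW ij')// andbT; apply/eqP => e.
        by move: ij'; rewrite (singular_preim_inj kS (esym e)) ltnn.
      have := bigkand_true phik (i := f i); rewrite f_homo// fij' => /(_ isT).
      case/kor_true => [/kneg_some/tp_neq_false//|].
      by move=> /(IHphi _ _ _ _ nuP) ->.
  + split=> // -[j' [jj' Jj' psij' phij']].
    (* Of the factors of this false disjunct, [tp] is never false, and [mc] and [psi] hold at [j'];
       so [phi] fails at some known time point [k]. *)
    have := H (f j'); rewrite f_homo// f_size => /(_ isT).
    case/kand_false => [/tp_neq_false//|].
    case/kand_false => [/mc_some/(_ _ _ (litv_stamp j) (litv_stamp j'))<-//|].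
    case/kand_false => [/(IHpsi _ _ _ _ nuP)<-//|].
    case/bigkand_false => k /andP[jk kj'] /kor_false[/kneg_some/tp_true kS].
    have [i fi] := f_onto (ltn_trans kj' (f_size j')) kS; rewrite -fi in kS jk kj' *.
    move=> /(IHphi _ _ _ _ nuP) <-; apply: phij'.
    by rewrite (f_lt kj') andbT; apply: singular_preim_le => //; right.
Qed.

End Refinement.

(** The letter evaluated by [obs_val] is singular, so it persists as a time point of [tw],
    necessarily with timestamp [t]. *)
Lemma obs_val_tw_val w tw t (nu : pvaluation Sg) nu' phi b :
  refines_tw w tw -> pext nu (fun x => Some (nu' x)) ->
  obs_val w t nu phi = Some b -> tw_val tw t nu' phi = Some b.
Proof.
move=> [f [fsize fhomo fdata fonto]] nuP; rewrite /obs_val.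
set P := (fun l => _); case: ifP => // iw semb.
have /asboolP It : P (nth init w (find P w)) by rewrite nth_find// has_find.
have [|j fj] := fonto _ iw; first by exists t.
have tj : stamp tw j = t.
  by have := litv_stamp fdata j; rewrite fj It.
rewrite -fj in semb; have satb := sem3_sat fsize fhomo fdata fonto nuP semb.
rewrite /tw_val asboolT; last by exists j.
congr Some; apply/asboolP/idP => [[i [ti]]|/satb]; last by exists j.
by rewrite (@stamp_inj tw i j) ?ti ?tj// satb.
Qed.

(** * Well-formed observations and their realization *)

Definition proper_letter l : bool :=
  `[< litv l !=set0 /\ forall t, litv l t -> 0 <= t >].

Definition before l l' : bool :=
  `[< forall s t, litv l s -> litv l' t -> s < t >].

(** The size is required to be positive because on the empty word [last] returns the unbounded
    default [init]. *)
Definition wf_obs w := [/\ all proper_letter w, pairwise before w,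
  (0 < size w)%N & ~ has_ubound (litv (last init w))].

Lemma before_sub l l1 l2 l3 : litv l2 `<=` litv l1 -> litv l3 `<=` litv l ->
  before l1 l -> before l2 l3.
Proof. by move=> s21 s3 /asboolP H; apply/asboolP => s t /s21 + /s3; exact: H. Qed.

(** Covers all three transformations, [m] being what replaces [l]. The condition on unbounded [l]
    serves the case of empty [v], where [m] must supply the new last letter. *)
Lemma wf_obs_replace u l m v :
  all (fun l' => `[< litv l' `<=` litv l >]) m ->
  all proper_letter m -> pairwise before m ->
  (~ has_ubound (litv l) ->
     (0 < size m)%N /\ ~ has_ubound (litv (last init m))) ->
  wf_obs (u ++ l :: v) -> wf_obs (u ++ m ++ v).
Proof.
move=> sub properm sortm lastm [].
rewrite /wf_obs !all_cat /= => /and3P[pu pl pv].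
rewrite !pairwise_cat allrel_catr allrel_consr /=.
move=> /and3P[/andP[ul uv] su /andP[lv sv]] _ lastuv.
have um : allrel before u m.
  move: ul; apply: sub_all => x xl; move: sub; apply: sub_all => y /asboolP yl.
  exact: before_sub xl.
have mv : allrel before m v.
  move: sub; apply: sub_all => x /asboolP xl; move: lv; apply: sub_all => y.
  exact: before_sub.
rewrite pu pv properm uv um mv su sortm sv; split=> //.
  case: v lastuv {pv uv lv sv mv} => [|a v]; last by rewrite !size_cat /= !addnS.
  by rewrite last_cat => /lastm[m0 _]; rewrite !size_cat addn0 addn_gt0 m0 orbT.
case: v lastuv {pv uv lv sv mv} => [|a v]; last by rewrite !last_cat.
rewrite !last_cat /= => /lastm[]; by case: (m).
Qed.


Lemma wf_init_obs : wf_obs (init_obs Sg).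
Proof.
split=> //=.
  by rewrite andbT; apply/asboolP; split=> //; exists 0; exact: lexx.
move=> [x xP]; have x1 := xP _ (ler_wpDl ler01 (normr_ge0 x)).
by move: (ler_norm x) x1; lra.
Qed.

Lemma refine1_wf w w' : refine1 w w' -> wf_obs w -> wf_obs w'.
Proof.
case=> {w w'} [u v I s r t nsI It|u v I s r nsI bI|u v t s r s' r' _ _] wf.
- have pI : forall x, I x -> 0 <= x.
    by case: wf; rewrite all_cat /= => /and3P[_ /asboolP[]].
  apply: (wf_obs_replace _ _ _ _ wf).
  + rewrite all_filter /= !andbT; apply/and3P; split; apply/implyP => _;
      apply/asboolP => x /=; [by case|by move=> ->|by case].
  + rewrite /drop_empty all_filter /= !andbT.
    apply/and3P; split; apply/implyP => /= /set0P ne; apply/asboolP;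
      split=> // x /=; [by case=> /pI|by move=> ->; exact: pI|by case=> /pI].
  + apply: pairwise_filter => /=; rewrite !andbT -andbA; apply/and3P; split;
      apply/asboolP => x y /=.
    * by case=> _ xt ->.
    * by case=> _ xt [_]; exact: lt_trans.
    * by move=> -> [].
  + move=> /= nI; rewrite /drop_empty /=.
    (* Unboundedness passes to the right part, which is therefore nonempty and survives [drop_empty]
       as the last letter. *)
    have tI : ~ has_ubound (I `&` [set x | t < x]).
      move=> [y yP]; apply: nI; exists (Num.max t y) => x Ix.
      rewrite le_max; case: (leP x t) => //= tx; exact: yP.
    have -> : I `&` [set x | t < x] != set0.
      by apply/negP => /eqP e; apply: tI; rewrite e; exists 0.
    by split; case: ifP => _; case: ifP.
- by apply: (wf_obs_replace (m := [::]) _ _ _ _ wf) => //= /(_ bI).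
- have pt : proper_letter (Letter [set t] s r).
    by case: wf; rewrite all_cat /= => /and3P[].
  apply: (wf_obs_replace (m := [:: Letter [set t] s' r'])) wf => //=.
  + by rewrite andbT; apply/asboolP.
  + by rewrite andbT.
Qed.

Lemma refines_wf w w' : refines w w' -> wf_obs w -> wf_obs w'.
Proof. by elim=> // {w w'} [w w' /refine1_wf //|w1 w2 w3 _ + _]; auto. Qed.

Lemma valid_obs_seq_wf (ws : nat -> word Sg) i : valid_obs_seq ws -> wf_obs (ws i).
Proof.
case=> ws0 wsS; elim: i => [|i IHi]; first by rewrite ws0; exact: wf_init_obs.
by case: (wsS i) => /refines_wf + _; apply.
Qed.

(** One time point is placed in each letter, and all further ones in the last letter, of index
    [n]. *)
Lemma wf_obs_realizable w : wf_obs w -> exists tw, refines_tw w tw.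
Proof.
move=> [/all_nthP-/(_ init) pw /(pairwiseP init) sw w0 lastw].
have [d0] := domain_inhabited Sg.
set n := (size w).-1; have nw : (n < size w)%N by rewrite prednK.
pose f j := minn j n; pose I j := litv (nth init w (f j)).
have fw j : (f j < size w)%N by rewrite (leq_ltn_trans (geq_minr _ _)).
have next j x : exists y, I j y /\ ((n <= j)%N -> x < y).
  case: (leqP n j) => [nj|jn]; last first.
    by case/asboolP: (pw _ (fw j)) => -[y Iy] _; exists y.
  apply: contrapT => H; case: lastw; exists x => y Iy.
  rewrite leNgt; apply/negP => xy; apply: H; exists y; split=> //.
  by rewrite /I /f (minn_idPr nj) nth_last.
have /choice[g gP] : forall jx : nat * rat, exists y,
    I jx.1 y /\ ((n <= jx.1)%N -> jx.2 < y).
  by case=> j x; exact: next.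
(* Inside the last letter, [st i] in the maximum forces increase and [j%:R] forces divergence.
   Between distinct letters, increase comes from their order. *)
pose st := fix st j := if j is i.+1 then g (j, Num.max (st i) j%:R) else g (0%N, 0).
have Ist j : I j (st j).
  by case: j => [|j] /=; [case: (gP (0%N, 0))|case: (gP (j.+1, Num.max (st j) j.+1%:R))].
have st_gt j : (n <= j)%N -> Num.max (st j) j.+1%:R < st j.+1.
  by move=> nj; case: (gP (j.+1, Num.max (st j) j.+1%:R)) => _; apply; exact: leqW.
have st_ge0 j : 0 <= st j.
  by case/asboolP: (pw _ (fw j)) => _; apply; exact: Ist.
have stS j : st j < st j.+1.
  case: (ltnP j n) => jn; last first.
    by have := st_gt _ jn; rewrite gt_max => /andP[].
  have /asboolP : before (nth init w (f j)) (nth init w (f j.+1)).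
    by apply: sw; rewrite ?inE ?fw// /f; rewrite (minn_idPl jn) (minn_idPl (ltnW jn)).
  by apply; exact: Ist.
have st_incr i j : (i < j)%N -> st i < st j by move/(homo_ltn lt_trans stS).
have st_progress t : exists i, t < st i.
  (* Large enough to be in the last letter and to exceed [t] by the Archimedean property. *)
  pose k := maxn n (Num.bound `|t|); exists k.+1.
  have := st_gt k (leq_maxl _ _); rewrite gt_max => /andP[_]; apply: lt_trans.
  apply: le_lt_trans (ler_norm _) _; apply: lt_le_trans (archi_boundP (normr_ge0 _)) _.
  by rewrite ler_nat leqW// leq_maxr.
(* Data that the letter leaves open is filled in arbitrarily. *)
pose ti j p := odflt set0 (linterp (nth init w (f j)) p).
pose tr j r := odflt d0 (lregs (nth init w (f j)) r).
exists (@TimedWord Sg st ti tr st_ge0 st_incr st_progress), f; split=> //.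
- by move=> i j ij; rewrite /f leq_min geq_minr andbT (leq_trans (geq_minl _ _)).
- move=> j; split=> //; first exact: Ist.
  + by move=> p A /= e; rewrite /ti e.
  + by move=> r d /= e; rewrite /tr e.
- move=> i iw _; exists i; apply/minn_idPl; rewrite -ltnS prednK//.
Qed.

(** All refining timed words agree on [b], and realizability makes the set of their values
    nonempty. *)
Lemma obs_val_tw_meet w t (nu : pvaluation Sg) nu' phi b :
  wf_obs w -> pext nu (fun x => Some (nu' x)) ->
  obs_val w t nu phi = Some b -> tw_meet w t nu' phi = Some b.
Proof.
move=> /wf_obs_realizable[tw wtw] nuP semb; apply/Meet_some; split.
  by exists (tw_val tw t nu' phi); exists tw.
by move=> _ [tw' wtw' <-]; exact: obs_val_tw_val semb.
Qed.

End Observations.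

Theorem mainTheorem2 (Sg : signature) (M : monitor Sg) :
  (obs_sound M -> sound M) /\ (complete M -> obs_complete M).
Proof.
split=> [soundM w phi wP nu i t b|completeM w phi wP nu i t t0].
  move=> /(soundM w phi wP (fun x => Some (nu x))).
  exact: obs_val_tw_meet (valid_obs_seq_wf i wP) _.
case semb: obs_val => [b|//] _; have [d] := domain_inhabited Sg.
(* Completeness needs a total valuation: undefined variables get an arbitrary [d]. The required
   verdict does not depend on the valuation. *)
apply: (completeM w phi wP (fun x => odflt d (nu x)) i t t0).
rewrite (obs_val_tw_meet (valid_obs_seq_wf i wP) _ semb)// => x c.
by move=> ->.
Qed.
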